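(* Let $(K_n,P_n)_{n\ge 1}$ be a scaling with $\theta_n=(K_n,P_n)$ for which the limit $\lim_{n\to\infty}q(\theta_n)=q^\star$ exists. Suppose that either (i) $0\le q^\star<1$, or (ii) $q^\star=1$ and $\lim_{n\to\infty}n^3\,\tau(\theta_n)=\infty$. Then $$\lim_{n\to\infty}\mathbb{P}\left[\mathbb{K}(n;\theta_n)\text{ contains at least one triangle}\right]=1 .$$
   Context: Random key graph: for positive integers $K\le P$ write $\theta=(K,P)$, and let $K_1(\theta),\dots,K_n(\theta)$ be i.i.d. random subsets, each uniformly distributed over the $K$-element subsets of a fixed set of $P$ keys. The random key graph $\mathbb{K}(n;\theta)$ has vertex set $\{1,\dots,n\}$, and distinct nodes $i,j$ are adjacent iff $K_i(\theta)\cap K_j(\theta)\neq\emptyset$. Define $q(\theta)=0$ if $P<2K$ and $q(\theta)=\binom{P-K}{K}/\binom{P}{K}$ if $2K\le P$ (this is the probability that two given distinct nodes are not adjacent). Define $\tau(\theta)=\frac{K^3}{P^2}+\left(\frac{K^2}{P}\right)^3$. A scaling is a pair of sequences $K,P$ of positive integers, with values denoted $K_n,P_n$ ($n=1,2,\dots$), such that $K_n\le P_n$ for all $n=2,3,\dots$; one writes $\theta_n=(K_n,P_n)$. *)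

(* Defs.v *)
From HB Require Import structures.
From mathcomp Require Import all_boot all_order all_algebra.
From mathcomp Require Import all_classical all_reals all_analysis.
Set Implicit Arguments.
Unset Strict Implicit.
Unset Printing Implicit Defensive.
Import Order.TTheory GRing.Theory Num.Theory.
Import numFieldNormedType.Exports.
Local Open Scope classical_set_scope.
Local Open Scope ring_scope.

(* The random key graph on n nodes with a pool of P keys and rings of K keys
   is built on its canonical sample space: an outcome w assigns to each node i
   a set of keys w i.  Nodes are 0, ..., n-1 instead of 1, ..., n. *)
Definition key_assignment (n P : nat) := {ffun 'I_n -> {set 'I_P}}.

(* If P < K there is no K-element subset and this is the zero function. *)
Definition key_ring_pmf (R : realType) (K P : nat) (A : {set 'I_P}) : R :=
  if #|A| == K then ('C(P, K)%:R)^-1 else 0.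

(* The product of the marginals: the key rings are i.i.d. *)
Definition key_assignment_pmf (R : realType) (n K P : nat)
    (w : key_assignment n P) : R :=
  \prod_(i < n) key_ring_pmf R K (w i).

Definition key_prob (R : realType) (n K P : nat)
    (E : pred (key_assignment n P)) : R :=
  \sum_(w : key_assignment n P | E w) key_assignment_pmf R K w.

Definition key_graph (n P : nat) (w : key_assignment n P) : rel 'I_n :=
  fun i j => (i != j) && (w i :&: w j != finset.set0).

Definition has_triangle (n : nat) (e : rel 'I_n) : bool :=
  [exists i, exists j, exists k, [&& e i j, e j k & e i k]].

Definition q (R : realType) (K P : nat) : R :=
  if (P < 2 * K)%N then 0 else 'C(P - K, K)%:R / 'C(P, K)%:R.

Definition tau (R : realType) (K P : nat) : R :=
  K%:R ^+ 3 / P%:R ^+ 2 + (K%:R ^+ 2 / P%:R) ^+ 3.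

(* Sequences are indexed from 1; the values at index 0 are unconstrained. *)
Definition scaling (K P : nat -> nat) : Prop :=
  (forall n, (1 <= n)%N -> (0 < K n)%N /\ (0 < P n)%N) /\
  (forall n, (2 <= n)%N -> (K n <= P n)%N).

(* Main.v *)
Require Import Defs.
From HB Require Import structures.
From mathcomp Require Import all_boot all_order all_algebra.
From mathcomp Require Import all_classical all_reals all_analysis.
From mathcomp Require Import ring lra zify.
Import Order.TTheory GRing.Theory Num.Theory.
Import numFieldNormedType.Exports.
Local Open Scope classical_set_scope.
Local Open Scope ring_scope.

(** Second moment method, restricted to tripartite triples: split 3m <= n nodes
    into three blocks of m and count the triangles with one vertex in each.
    Given one key ring, the probability beta that two further nodes complete a
    triangle does not depend on that ring, so two triples sharing at most one
    node are uncorrelated and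
      P(no triangle) <= 3 rho / (m beta)^2 + 1 / (m^3 beta),
    where rho is the probability that two triples sharing an edge are both
    triangles. With x = K^2/P and y = K/P, so that tau = x y + x^3, one has
    beta >= (1 - q)^3 and beta >= (1 - q) y with 1 - q >= x / (1 + x), hence
    beta >= tau / 16 when x <= 1. A common neighbour of two adjacent nodes uses
    a key that they share or two different keys, which gives
    x rho <= 4 tau^2 when x <= 1, and m^2 x tends to infinity because
    tau <= 2 x^2. *)

Set Implicit Arguments.
Unset Strict Implicit.
Unset Printing Implicit Defensive.

(** * Weighted means over a finite type *)

Section Mean.
Variables (R : realFieldType) (T : finType) (mu : T -> R).

Definition mean (F : T -> R) : R := \sum_a mu a * F a.

Lemma eq_mean F G : F =1 G -> mean F = mean G.
Proof. by move=> FG; apply: eq_bigr => a _; rewrite FG. Qed.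

Lemma eq_mean_supp F G :
  (forall a, mu a != 0 -> F a = G a) -> mean F = mean G.
Proof.
move=> FG; apply: eq_bigr => a _.
by have [->|/FG->] := eqVneq (mu a) 0; rewrite ?mul0r.
Qed.

Lemma meanZ c F : mean (fun a => c * F a) = c * mean F.
Proof. by rewrite /mean mulr_sumr; apply: eq_bigr => a _; rewrite mulrCA. Qed.

Lemma meanZr c F : mean (fun a => F a * c) = mean F * c.
Proof. by rewrite mulrC -meanZ; apply: eq_mean => a; rewrite mulrC. Qed.

Lemma meanD F G : mean (fun a => F a + G a) = mean F + mean G.
Proof. by rewrite /mean -big_split; apply: eq_bigr => a _; rewrite mulrDr. Qed.

Lemma meanB F G : mean (fun a => F a - G a) = mean F - mean G.
Proof. by rewrite /mean -sumrB; apply: eq_bigr => a _; rewrite mulrBr. Qed.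

Lemma mean_sum (J : Type) (r : seq J) (Q : pred J) (F : J -> T -> R) :
  mean (fun a => \sum_(j <- r | Q j) F j a) = \sum_(j <- r | Q j) mean (F j).
Proof.
by rewrite /mean exchange_big; apply: eq_bigr => a _; rewrite mulr_sumr.
Qed.

Hypothesis mu_ge0 : forall a, 0 <= mu a.

Lemma ler_mean F G :
  (forall a, mu a != 0 -> F a <= G a) -> mean F <= mean G.
Proof.
move=> FG; apply: ler_sum => a _.
by have [->|/FG Fa] := eqVneq (mu a) 0; rewrite ?mul0r ?ler_wpM2l.
Qed.

Lemma mean_ge0 F : (forall a, 0 <= F a) -> 0 <= mean F.
Proof. by move=> F0; apply: sumr_ge0 => a _; apply: mulr_ge0. Qed.

Hypothesis mu1 : \sum_a mu a = 1.

Lemma mean_cst c : mean (fun=> c) = c.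
Proof. by rewrite /mean -mulr_suml mu1 mul1r. Qed.

End Mean.

Lemma exchange_mean (R : realFieldType) (T S : finType) (mu : T -> R)
    (nu : S -> R) (F : T -> S -> R) :
  mean mu (fun a => mean nu (F a)) = mean nu (fun b => mean mu (F^~ b)).
Proof.
rewrite /mean; under eq_bigr do rewrite mulr_sumr.
rewrite exchange_big; apply: eq_bigr => b _; rewrite mulr_sumr.
by apply: eq_bigr => a _; rewrite mulrCA.
Qed.

(** * Product weights and resampling of coordinates *)

Section ProductMean.
Variables (R : realFieldType) (T I : finType) (mu : T -> R).
Hypothesis mu1 : \sum_a mu a = 1.

Definition prod_pmf (w : {ffun I -> T}) : R := \prod_i mu (w i).

Lemma prod_pmf_sum1 : \sum_w prod_pmf w = 1.
Proof.
rewrite /prod_pmf -(bigA_distr_bigA (fun=> mu)) /=.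
by apply: big1 => i _.
Qed.

Definition upd (w : {ffun I -> T}) (i : I) (a : T) : {ffun I -> T} :=
  [ffun j => if j == i then a else w j].

Lemma upd_same w i a : upd w i a i = a.
Proof. by rewrite ffunE eqxx. Qed.

Lemma upd_other w i a j : j != i -> upd w i a j = w j.
Proof. by rewrite ffunE => /negPf->. Qed.

(* Swapping [a] with [w i] is a weight-preserving involution of the pairs
   [(a, w)]. *)
Lemma mean_resample (i : I) (F : {ffun I -> T} -> R) :
  mean prod_pmf F = mean mu (fun a => mean prod_pmf (fun w => F (upd w i a))).
Proof.
rewrite -[LHS](mean_cst mu1).
rewrite /mean; under eq_bigr do rewrite mulr_sumr.
under [RHS]eq_bigr do rewrite mulr_sumr.
rewrite !pair_big /=.
pose sw (p : T * {ffun I -> T}) := (p.2 i, upd p.2 i p.1).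
have swK : involutive sw.
  move=> [a w]; rewrite /sw /= upd_same; congr (_, _); apply/ffunP => j.
  by rewrite !ffunE; case: eqP => // ->.
rewrite (reindex_inj (inv_inj swK)); apply: eq_bigr => -[a w] _ /=.
rewrite !mulrA; congr (_ * _).
rewrite /prod_pmf (bigD1 i) //= [in RHS](bigD1 i) //= upd_same.
rewrite mulrCA; congr (_ * (_ * _)).
by apply: eq_bigr => j ji; rewrite upd_other.
Qed.

(* The mean of [F] at two draws that coincide if [e] holds and are
   independent otherwise. *)
Definition mean_pair (e : bool) (F : T -> T -> R) : R :=
  if e then mean mu (fun a => F a a)
  else mean mu (fun a => mean mu (F a)).

Lemma eq_mean_pair e F G : F =2 G -> mean_pair e F = mean_pair e G.
Proof.
move=> FG; rewrite /mean_pair; case: e; apply: eq_mean => a //.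
by apply: eq_mean.
Qed.

(** The hypotheses say that [F a b] ignores the coordinates [i] and [i'], so resampling them turns
    the values read there into fresh draws. *)
Lemma mean_two_coords (i i' : I) (F : T -> T -> {ffun I -> T} -> R) :
  (forall a b w c, F a b (upd w i c) = F a b w) ->
  (forall a b w c, F a b (upd w i' c) = F a b w) ->
  mean prod_pmf (fun w => F (w i) (w i') w) =
  mean_pair (i == i') (fun a b => mean prod_pmf (F a b)).
Proof.
move=> Fi Fi'; rewrite (mean_resample i) /mean_pair.
case: eqVneq => [<-|ii'].
  apply: eq_mean => a; apply: eq_mean => w.
  by rewrite /= upd_same Fi.
apply: eq_mean => a; rewrite (mean_resample i').
apply: eq_mean => b; apply: eq_mean => w.
by rewrite /= Fi upd_same upd_other 1?eq_sym // upd_same Fi'.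
Qed.

(** Coincidences occur only within the pairs [(i, i')], [(j, j')], [(k, k')], so [mean_two_coords]
    peels off one pair at a time. *)
Lemma mean_six_coords (G : T -> T -> T -> T -> T -> T -> R)
    (i i' j j' k k' : I) :
  {in [:: i; i'], forall x, x \notin [:: j; j'; k; k']} ->
  {in [:: j; j'], forall x, x \notin [:: k; k']} ->
  mean prod_pmf (fun w => G (w i) (w i') (w j) (w j') (w k) (w k')) =
  mean_pair (i == i') (fun a a' => mean_pair (j == j') (fun b b' =>
    mean_pair (k == k') (G a a' b b'))).
Proof.
move=> dI dJ.
have nI x : x \in [:: i; i'] -> [/\ j != x, j' != x, k != x & k' != x].
  by move=> /dI; rewrite !inE !negb_or ![x == _]eq_sym => /and4P.
have nJ x : x \in [:: j; j'] -> (k != x) && (k' != x).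
  by move=> /dJ; rewrite !inE !negb_or ![x == _]eq_sym.
have mem2 (x y : I) : (x \in [:: x; y]) * (y \in [:: x; y]).
  by rewrite !inE !eqxx orbT.
have [[? ? ? ?] [? ? ? ?]] := (nI _ (mem2 i i').1, nI _ (mem2 i i').2).
have /andP[? ?] := nJ _ (mem2 j j').1; have /andP[? ?] := nJ _ (mem2 j j').2.
rewrite (@mean_two_coords i i'
  (fun a a' w => G a a' (w j) (w j') (w k) (w k'))); first last.
- by move=> *; rewrite !upd_other.
- by move=> *; rewrite !upd_other.
apply: eq_mean_pair => a a'.
rewrite (@mean_two_coords j j'
  (fun b b' w => G a a' b b' (w k) (w k'))); first last.
- by move=> *; rewrite !upd_other.
- by move=> *; rewrite !upd_other.
apply: eq_mean_pair => b b'.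
rewrite (@mean_two_coords k k' (fun c c' _ => G a a' b b' c c')) //.
apply: eq_mean_pair => c c'.
by rewrite mean_cst // prod_pmf_sum1.
Qed.

End ProductMean.

(** * Second moment bound for symmetric tripartite triples *)

Section SecondMoment.
Variables (R : realFieldType) (T I : finType) (mu : T -> R).
Hypothesis mu_ge0 : forall a, 0 <= mu a.
Hypothesis mu1 : \sum_a mu a = 1.

Lemma prod_pmf_ge0 (w : {ffun I -> T}) : 0 <= prod_pmf mu w.
Proof. exact: prodr_ge0. Qed.

(** Chebyshev's argument: where [X] vanishes its squared deviation is the squared mean, and the rest
    of the variance is nonnegative. *)
Lemma second_moment_method (X : {ffun I -> T} -> R) :
  (\sum_(w | X w == 0) prod_pmf mu w) * mean (prod_pmf mu) X ^+ 2 <=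
  mean (prod_pmf mu) (fun w => X w ^+ 2) - mean (prod_pmf mu) X ^+ 2.
Proof.
set E := mean _ X.
have -> : mean (prod_pmf mu) (fun w => X w ^+ 2) - E ^+ 2 =
          mean (prod_pmf mu) (fun w => (X w - E) ^+ 2).
  under [RHS]eq_mean do rewrite sqrrB.
  rewrite meanD meanB mean_cst ?prod_pmf_sum1 //.
  under [X in _ - X + _]eq_mean do rewrite -mulr_natr.
  by rewrite !meanZr -/E; ring.
rewrite mulr_suml [leRHS](bigID (fun w => X w == 0)) /=.
rewrite -[leLHS]addr0 lerD //.
  by apply: ler_sum => w /eqP->; rewrite sub0r sqrrN.
by apply: sumr_ge0 => w _; rewrite mulr_ge0 ?prod_pmf_ge0 ?sqr_ge0.
Qed.

Variables (g : T -> T -> T -> bool) (beta : R).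
Hypothesis g_swap12 : forall a b c, g a b c = g b a c.
Hypothesis g_swap23 : forall a b c, g a b c = g a c b.
Hypothesis g_mean : forall a, mu a != 0 ->
  mean mu (fun b => mean mu (fun c => (g a b c)%:R)) = beta.

(* The probability that two triples sharing two draws both satisfy [g]. *)
Definition shared_pair_mean : R :=
  mean mu (fun a => mean mu (fun b => mean mu (fun c => (g a b c)%:R) ^+ 2)).

Let g_rot a b c : g a b c = g c a b.
Proof. by rewrite g_swap23 g_swap12. Qed.

Lemma mean3_of_cond_mean :
  mean mu (fun a => mean mu (fun b => mean mu (fun c => (g a b c)%:R))) = beta.
Proof. by rewrite (eq_mean_supp g_mean) mean_cst. Qed.

Lemma shared_pair_mean_ge0 : 0 <= shared_pair_mean.
Proof.
by apply: mean_ge0 => // a; apply: mean_ge0 => // b; rewrite sqr_ge0.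
Qed.

Let beta_ge0 : 0 <= beta.
Proof.
rewrite -mean3_of_cond_mean; do 3! (apply: mean_ge0 => // ?).
Qed.

(** The booleans record the positions where the two triples share a draw. With at most one shared
    draw the mean is [beta ^+ 2], by conditioning on it; two shared draws give [shared_pair_mean]
    and three give [beta]. Adding these up yields a single formula for all eight cases. *)
Lemma mean_pair_triples_le (e1 e2 e3 : bool) :
  mean_pair mu e1 (fun a a' => mean_pair mu e2 (fun b b' =>
    mean_pair mu e3 (fun c c' => (g a b c)%:R * (g a' b' c')%:R))) <=
  beta ^+ 2
  + (e1%:R * e2%:R + e1%:R * e3%:R + e2%:R * e3%:R) * shared_pair_mean
  + e1%:R * e2%:R * e3%:R * beta.
Proof.
have meanM (F G : T -> R) : mean mu (fun c => mean mu (fun c' => F c * G c'))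
    = mean mu F * mean mu G.
  by under eq_mean do rewrite meanZ; rewrite meanZr.
pose h a b := mean mu (fun c => (g a b c)%:R : R).
have beta2 : mean mu (fun a => mean mu (h a) * mean mu (h a)) = beta ^+ 2.
  rewrite (@eq_mean_supp _ _ _ _ (fun=> beta ^+ 2)) ?mean_cst // => a a0.
  by rewrite g_mean.
have h_sym a b : h a b = h b a by apply: eq_mean => c; rewrite g_swap12.
have h13 a c : mean mu (fun b => (g a b c)%:R : R) = h a c.
  by apply: eq_mean => b; rewrite g_swap23.
have h23 b c : mean mu (fun a => (g a b c)%:R : R) = h b c.
  by apply: eq_mean => a; rewrite -g_rot.
have exch3 (F : T -> T -> T -> R) :
    mean mu (fun b => mean mu (fun b' => mean mu (fun c => F b b' c))) =
    mean mu (fun c => mean mu (fun b => mean mu (fun b' => F b b' c))).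
  by under eq_mean do rewrite exchange_mean; rewrite exchange_mean.
(* One shared draw outside the first position: moving it outermost reduces to [beta2]. *)
have hh : mean mu (fun a => mean mu (fun a' => mean mu (fun b =>
    h a b * h a' b))) = beta ^+ 2.
  rewrite exch3 -beta2; apply: eq_mean => b; rewrite meanM.
  by congr (_ * _); apply: eq_mean => a.
have bool_sqr (b : bool) : b%:R * b%:R = b%:R :> R.
  by case: b; rewrite ?mul1r ?mul0r.
rewrite /mean_pair; case: e1 e2 e3 => [] [] [];
  rewrite ?(mul1r, mul0r, mulr0, add0r, addr0).
- under eq_mean do under eq_mean do under eq_mean do rewrite bool_sqr.
  by rewrite mean3_of_cond_mean lerDr addr_ge0 ?sqr_ge0 // !mulr_ge0 ?addr_ge0
    ?shared_pair_mean_ge0.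
- under eq_mean do under eq_mean do rewrite meanM -expr2.
  by rewrite lerDr sqr_ge0.
- under eq_mean do rewrite exch3; under eq_mean do under eq_mean do
    rewrite meanM h13 -expr2.
  by rewrite lerDr sqr_ge0.
- under eq_mean do under eq_mean do under eq_mean do rewrite meanM.
  by under eq_mean do rewrite meanM; rewrite beta2.
- rewrite exch3; under eq_mean do rewrite exch3.
  under eq_mean do under eq_mean do rewrite meanM h23 -expr2.
  by rewrite lerDr sqr_ge0.
- by under eq_mean do under eq_mean do under eq_mean do rewrite meanM;
    rewrite hh.
- under eq_mean do under eq_mean do rewrite exch3.
  by under eq_mean do under eq_mean do under eq_mean do rewrite meanM !h13;
    rewrite hh.
- under eq_mean do under eq_mean do under eq_mean do under eq_mean do
    rewrite meanM.
  under eq_mean do under eq_mean do rewrite meanM.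
  by rewrite meanM -/(h _) mean3_of_cond_mean -expr2.
Qed.

Lemma sum_indicator_affine (J : finType) (i : J) (x y : R) :
  \sum_(j : J) (x + (i == j)%:R * y) = #|J|%:R * x + y.
Proof.
rewrite big_split /= sumr_const -mulr_suml mulr_natl; congr (_ + _).
rewrite (bigD1 i) //= eqxx big1 ?addr0 ?mul1r // => j.
by rewrite eq_sym => /negPf->.
Qed.

Section Tripartite.
Variables (J : finType) (u v s : J -> I).
Hypotheses (u_inj : injective u) (v_inj : injective v) (s_inj : injective s).
Hypothesis (uv : forall i j, u i != v j) (us : forall i j, u i != s j).
Hypothesis vs : forall i j, v i != s j.

(** The images of [u], [v] and [s] are disjoint blocks, so two counted triples can share nodes only
    in equal positions, the pattern handled by [mean_six_coords]. *)
Definition count_triples (w : {ffun I -> T}) : R :=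
  \sum_(i : J) \sum_(j : J) \sum_(k : J) (g (w (u i)) (w (v j)) (w (s k)))%:R.

Let m : R := #|J|%:R.

Let sum_cst (c : R) : \sum_(i : J) c = m * c.
Proof. by rewrite sumr_const -mulr_natl. Qed.

Let mean_two_triples (i j k i' j' k' : J) (F : bool -> bool -> R) :
  mean (prod_pmf mu) (fun w => F (g (w (u i)) (w (v j)) (w (s k)))
                                 (g (w (u i')) (w (v j')) (w (s k')))) =
  mean_pair mu (i == i') (fun a a' => mean_pair mu (j == j') (fun b b' =>
    mean_pair mu (k == k') (fun c c' => F (g a b c) (g a' b' c')))).
Proof.
rewrite (mean_six_coords mu1 (fun a a' b b' c c' => F (g a b c) (g a' b' c'))).
- by rewrite (inj_eq u_inj) (inj_eq v_inj) (inj_eq s_inj).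
- by move=> x; rewrite !inE => /orP[]/eqP->;
     rewrite !(negPf (uv _ _)) !(negPf (us _ _)).
- by move=> x; rewrite !inE => /orP[]/eqP->; rewrite !(negPf (vs _ _)).
Qed.

Lemma mean_count_triples :
  mean (prod_pmf mu) count_triples = m ^+ 3 * beta.
Proof.
rewrite /count_triples mean_sum.
under eq_bigr do rewrite mean_sum.
under eq_bigr do under eq_bigr do rewrite mean_sum.
under eq_bigr => i _ do under eq_bigr => j _ do under eq_bigr => k _ do
  rewrite (mean_two_triples i j k i j k (fun b _ => b%:R)) !eqxx /= mean3_of_cond_mean.
by rewrite !sum_cst; ring.
Qed.

(** The square expands into [m ^+ 6] pairs of triples, each bounded by [mean_pair_triples_le]. For
    each of the three choices of two positions, [m ^+ 4] pairs agree there, and [m ^+ 3] pairs agree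
    everywhere. *)
Lemma mean_sqr_count_triples_le :
  mean (prod_pmf mu) (fun w => count_triples w ^+ 2) <=
  m ^+ 6 * beta ^+ 2 + 3 * m ^+ 4 * shared_pair_mean + m ^+ 3 * beta.
Proof.
have cross i j k :
    mean (prod_pmf mu) (fun w => (g (w (u i)) (w (v j)) (w (s k)))%:R *
                                 count_triples w) <=
    m ^+ 3 * beta ^+ 2 + 3 * m * shared_pair_mean + beta.
  rewrite /count_triples.
  under eq_mean do rewrite mulr_sumr.
  rewrite mean_sum.
  have -> : m ^+ 3 * beta ^+ 2 + 3 * m * shared_pair_mean + beta =
    \sum_i' \sum_j' \sum_k' (beta ^+ 2 + ((i == i')%:R * (j == j')%:R +
      (i == i')%:R * (k == k')%:R + (j == j')%:R * (k == k')%:R)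
        * shared_pair_mean
      + (i == i')%:R * (j == j')%:R * (k == k')%:R * beta).
    (* The indicator sums collapse from the innermost outwards, each summand being first put in
       affine form. *)
    pose r := shared_pair_mean.
    under eq_bigr => i' _.
      under eq_bigr => j' _.
        rewrite (eq_bigr (fun k' =>
          (beta ^+ 2 + (i == i')%:R * (j == j')%:R * r) +
          (k == k')%:R * ((i == i')%:R * r + (j == j')%:R * r +
             (i == i')%:R * (j == j')%:R * beta))); last first.
          by move=> k' _; rewrite -/r; ring.
        rewrite sum_indicator_affine -/m.
        have -> : m * (beta ^+ 2 + (i == i')%:R * (j == j')%:R * r) +
           ((i == i')%:R * r + (j == j')%:R * r +
             (i == i')%:R * (j == j')%:R * beta) =
           (m * beta ^+ 2 + (i == i')%:R * r) + (j == j')%:R *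
             (m * (i == i')%:R * r + r + (i == i')%:R * beta) by ring.
        over.
      rewrite sum_indicator_affine -/m.
      have -> : m * (m * beta ^+ 2 + (i == i')%:R * r) +
             (m * (i == i')%:R * r + r + (i == i')%:R * beta) =
          (m ^+ 2 * beta ^+ 2 + r) + (i == i')%:R * (m * r + m * r + beta)
        by ring.
      over.
    by rewrite sum_indicator_affine -/m -/r; ring.
  apply: ler_sum => i' _; under eq_mean do rewrite mulr_sumr.
  rewrite mean_sum; apply: ler_sum => j' _; under eq_mean do rewrite mulr_sumr.
  rewrite mean_sum; apply: ler_sum => k' _.
  rewrite (mean_two_triples i j k i' j' k' (fun b b' => b%:R * b'%:R)).
  exact: mean_pair_triples_le.
set B := m ^+ 3 * beta ^+ 2 + 3 * m * shared_pair_mean + beta in cross.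
have -> : m ^+ 6 * beta ^+ 2 + 3 * m ^+ 4 * shared_pair_mean + m ^+ 3 * beta =
    \sum_(i : J) \sum_(j : J) \sum_(k : J) B.
  by rewrite !sum_cst /B; ring.
under eq_mean => w do rewrite expr2 {1}/count_triples mulr_suml.
rewrite mean_sum; apply: ler_sum => i _; under eq_mean do rewrite mulr_suml.
rewrite mean_sum; apply: ler_sum => j _; under eq_mean do rewrite mulr_suml.
rewrite mean_sum; apply: ler_sum => k _.
exact: cross.
Qed.

Lemma prob_no_triple_le : 0 < m -> 0 < beta ->
  \sum_(w | count_triples w == 0) prod_pmf mu w <=
  3 * shared_pair_mean / (m * beta) ^+ 2 + (m ^+ 3 * beta)^-1.
Proof.
move=> m0 b0; have := second_moment_method count_triples.
rewrite mean_count_triples; set p := \sum_(w | _) _ => Hp.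
have := mean_sqr_count_triples_le; set S := mean _ _ => HS.
have d0 : 0 < (m ^+ 3 * beta) ^+ 2.
  by rewrite exprn_gt0 // mulr_gt0 // exprn_gt0.
rewrite -(ler_pM2r d0); apply: le_trans Hp _.
have -> : (3 * shared_pair_mean / (m * beta) ^+ 2 + (m ^+ 3 * beta)^-1) *
  (m ^+ 3 * beta) ^+ 2 = 3 * m ^+ 4 * shared_pair_mean + m ^+ 3 * beta.
  by field; rewrite !gt_eqF.
rewrite lerBlDr; apply: le_trans HS _.
lra.
Qed.

End Tripartite.
End SecondMoment.

(** * Random key rings and the triangles that they form *)

Section KeyRings.
Variables (R : realType) (K P : nat).
Hypotheses (K_gt0 : (0 < K)%N) (leKP : (K <= P)%N).

Local Notation ring := {set 'I_P}.
Local Notation mu := (@key_ring_pmf R K P).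

Let y : R := K%:R / P%:R.
Let x : R := K%:R ^+ 2 / P%:R.

Let P_gt0 : (0 < P)%N. Proof. exact: leq_trans leKP. Qed.
Let PR_gt0 : 0 < P%:R :> R. Proof. by rewrite ltr0n. Qed.
Let y_ge0 : 0 <= y. Proof. by rewrite divr_ge0. Qed.
Let x_ge0 : 0 <= x. Proof. by rewrite divr_ge0 ?exprn_ge0. Qed.
Let bin_gt0R : 0 < 'C(P, K)%:R :> R. Proof. by rewrite ltr0n bin_gt0. Qed.
Let x_eq : x = K%:R * y. Proof. by rewrite /x /y mulrA. Qed.
Let y_le1 : y <= 1.
Proof. by rewrite ler_pdivrMr // mul1r ler_nat. Qed.

Let y_compl : 1 - y = (P - K)%:R / P%:R.
Proof. by rewrite natrB // mulrBl divff ?gt_eqF. Qed.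

Lemma key_ring_pmf_ge0 A : 0 <= mu A.
Proof. by rewrite /key_ring_pmf; case: ifP; rewrite ?invr_ge0 ?ler0n. Qed.

Lemma key_ring_pmf_supp A : mu A != 0 -> #|A| = K.
Proof. by rewrite /key_ring_pmf; case: (_ =P K) => // _; rewrite eqxx. Qed.

Lemma mean_key_ring_pred (Q : pred ring) :
  mean mu (fun A => (Q A)%:R) =
  #|[set A : ring | Q A & #|A| == K]|%:R / 'C(P, K)%:R.
Proof.
rewrite /mean /key_ring_pmf -sum1_card natr_sum mulr_suml big_mkcond /=.
rewrite [RHS]big_mkcond /=; apply: eq_bigr => A _; rewrite inE.
by case: (Q A); case: (#|A| == K); rewrite ?mulr1 ?mulr0 ?mul1r.
Qed.

Lemma key_ring_pmf_sum1 : \sum_A mu A = 1.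
Proof.
have := mean_key_ring_pred predT; rewrite /mean.
under eq_bigr do rewrite mulr1.
by move=> ->; rewrite card_draws card_ord divff ?gt_eqF.
Qed.

Let mu0 := key_ring_pmf_ge0.
Let mu1 := key_ring_pmf_sum1.

Definition meets (A B : ring) : bool := A :&: B != finset.set0.

Lemma meetsC A B : meets A B = meets B A.
Proof. by rewrite /meets finset.setIC. Qed.

Definition miss_prob (s : nat) : R := 'C(P - s, K)%:R / 'C(P, K)%:R.

Lemma mean_miss S : mean mu (fun A => (~~ meets A S)%:R) = miss_prob #|S|.
Proof.
rewrite mean_key_ring_pred /miss_prob -[X in 'C(X - _, K)](card_ord P).
rewrite -(cardsC S) addKn -cards_draws; congr (_%:R / _).
by apply: eq_card => A; rewrite !inE negbK setI_eq0 finset.disjoints_subset.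
Qed.

Lemma mean_meets S : mean mu (fun A => (meets A S)%:R) = 1 - miss_prob #|S|.
Proof.
rewrite -mean_miss -[X in X - _](mean_cst mu1) -meanB.
by apply: eq_mean => A; case: meets; rewrite /= ?subr0 ?subrr.
Qed.

Definition meets_both (A B : ring) : R :=
  mean mu (fun C => (meets C A)%:R * (meets C B)%:R).

(** Inclusion-exclusion: a ring misses both [A] and [B] exactly when it misses their union. *)
Lemma meets_bothE A B :
  meets_both A B =
  1 - miss_prob #|A| - miss_prob #|B| + miss_prob #|A :|: B|.
Proof.
rewrite -!mean_miss -[X in X - _ - _](mean_cst mu1) -!meanB -meanD.
apply: eq_mean => C; rewrite /meets finset.setIUr finset.setU_eq0.
by case: (_ == _); case: (_ == _); rewrite /=; ring.
Qed.

Lemma miss_prob_le s t : (s <= t)%N -> miss_prob t <= miss_prob s.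
Proof.
move=> st; rewrite ler_wpM2r ?invr_ge0 ?ler0n // ler_nat.
by apply: leq_bin2l; apply: leq_sub2l.
Qed.

(** For [s < P], avoiding one more key multiplies the probability by [(P - s - K) / (P - s)], which
    is at most [1 - y]. *)
Lemma miss_prob_exp s : miss_prob s <= (1 - y) ^+ s.
Proof.
elim: s => [|s IH]; first by rewrite /miss_prob subn0 divff ?gt_eqF.
have y1 : 0 <= 1 - y by rewrite subr_ge0.
rewrite exprS; apply: le_trans (ler_wpM2l y1 IH).
rewrite /miss_prob mulrA ler_wpM2r ?invr_ge0 ?ler0n //.
rewrite y_compl mulrAC ler_pdivlMr // -!natrM ler_nat subnS.
case: (posnP (P - s)) => [->|Ps]; first by rewrite /= bin0n gtn_eqF.
(* The identity [n * 'C(n.-1, K) = (n - K) * 'C(n, K)] at [n = P - s] reduces the claim to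
   [(P - s - K) * P <= (P - s) * (P - K)]. *)
rewrite -(leq_pmul2l Ps) mulnA mul_bin_down mulnAC mulnA.
rewrite leq_mul2r; apply/orP; right; nia.
Qed.

Lemma miss_prob1 : miss_prob 1 = 1 - y.
Proof.
rewrite /miss_prob subn1 y_compl.
apply/eqP; rewrite eqr_div ?(gt_eqF bin_gt0R, gt_eqF PR_gt0) //.
by rewrite -!natrM eqr_nat mulnC mul_bin_down.
Qed.

Lemma meets1 k C : meets C [set k]%SET = (k \in C).
Proof. by rewrite meetsC /meets setI_eq0 finset.disjoints1 negbK. Qed.

Lemma mean_mem k : mean mu (fun C => (k \in C)%:R) = y.
Proof.
under eq_mean do rewrite -meets1.
by rewrite mean_meets cards1 miss_prob1 subKr.
Qed.

(** Memberships of different keys are negatively correlated: inclusion-exclusion combines with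
    [miss_prob 2 <= (1 - y) ^+ 2]. *)
Lemma mean_mem2_le k l : k != l ->
  mean mu (fun C => (k \in C)%:R * (l \in C)%:R) <= y ^+ 2.
Proof.
move=> kl; under eq_mean do rewrite -!meets1.
rewrite -[leLHS]/(meets_both _ _) meets_bothE !cards1 cards2 kl miss_prob1.
by have := miss_prob_exp 2; rewrite expr2; nra.
Qed.

Let Q : R := miss_prob K.
Let Q2 : R := miss_prob (2 * K).

(* [(1 - Q) ^+ 2] is the mean of [meets_both A] over all second rings; the
   subtracted term is the contribution of those disjoint from [A]. *)
Definition triangle_prob : R := (1 - Q) ^+ 2 - Q * (1 - 2 * Q + Q2).

Definition triangle (A B C : ring) : bool :=
  [&& meets A B, meets B C & meets A C].

Lemma triangle_swap12 A B C : triangle A B C = triangle B A C.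
Proof. by rewrite /triangle (meetsC A B); do 3! case: meets. Qed.

Lemma triangle_swap23 A B C : triangle A B C = triangle A C B.
Proof. by rewrite /triangle (meetsC B C); do 3! case: meets. Qed.

Lemma mean_triangle A B :
  mean mu (fun C => (triangle A B C)%:R) = (meets A B)%:R * meets_both A B.
Proof.
rewrite -meanZ; apply: eq_mean => C.
by rewrite /triangle -!mulnb !natrM (meetsC B) (meetsC A C); ring.
Qed.

(** For a fixed third ring [C], the second ring meets [C] with probability [1 - Q] whatever [C] is,
    so the two events contribute a product. *)
Lemma mean_meets_both (A : ring) :
  #|A| = K -> mean mu (meets_both A) = (1 - Q) ^+ 2.
Proof.
move=> cA; rewrite exchange_mean.
rewrite (@eq_mean_supp _ _ _ _ (fun C => (meets C A)%:R * (1 - Q))); last first.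
  move=> C /key_ring_pmf_supp cC; rewrite meanZ; congr (_ * _).
  by under eq_mean do rewrite meetsC; rewrite mean_meets cC.
by rewrite meanZr mean_meets cA expr2.
Qed.

(** All rings [B] disjoint from [A] have a union of size [2 * K] with it, so [meets_both A B] is
    constant on them. Subtracting their share from [mean_meets_both] leaves the rings that meet
    [A]. *)
Lemma mean2_triangle A : mu A != 0 ->
  mean mu (fun B => mean mu (fun C => (triangle A B C)%:R)) = triangle_prob.
Proof.
move=> /key_ring_pmf_supp cA; rewrite /triangle_prob -(mean_meets_both cA).
set p0 := 1 - _ + _.
have -> : Q = mean mu (fun B => (~~ meets B A)%:R) by rewrite mean_miss cA.
rewrite -meanZr -meanB; apply: eq_mean_supp => B /key_ring_pmf_supp cB.
rewrite mean_triangle meetsC; case: (boolP (meets B A)) => /=.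
  by rewrite mul0r subr0 mul1r.
rewrite /meets negbK => /eqP BA0; rewrite meets_bothE cA cB -/Q.
rewrite finset.setUC cardsU BA0 cards0 subn0 cA cB addnn -mul2n -/Q2 /p0 /=.
ring.
Qed.

(** The left side is the value for disjoint rings; overlapping rings have a smaller union, which is
    missed at least as often. *)
Lemma disjoint_meets_both_le (A B : ring) : #|A| = K -> #|B| = K ->
  1 - 2 * Q + Q2 <= meets_both A B.
Proof.
move=> cA cB; rewrite meets_bothE cA cB -/Q.
have : Q2 <= miss_prob #|A :|: B|.
  by apply: miss_prob_le; rewrite cardsU cA cB mul2n -addnn leq_subr.
lra.
Qed.

(** Disjoint rings minimise [meets_both], so their value is at most the mean [(1 - Q) ^+ 2]; putting
    this mean in its place in [triangle_prob] gives the cube. *)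
Lemma triangle_prob_ge_cube : (1 - Q) ^+ 3 <= triangle_prob.
Proof.
have Q0 : 0 <= Q by rewrite divr_ge0.
have p0 : 1 - 2 * Q + Q2 <= (1 - Q) ^+ 2.
  rewrite -[leLHS](mean_cst mu1) -[leRHS](mean_cst mu1).
  apply: ler_mean => // A /key_ring_pmf_supp cA.
  rewrite -(mean_meets_both cA) -[leLHS](mean_cst mu1).
  by apply: ler_mean => // B /key_ring_pmf_supp; apply: disjoint_meets_both_le.
rewrite /triangle_prob; have := ler_wpM2l Q0 p0; lra.
Qed.

Lemma meets_both_ge (A B : ring) : meets A B -> y <= meets_both A B.
Proof.
move=> /finset.set0Pn[k]; rewrite inE => /andP[kA kB].
rewrite -(mean_mem k); apply: ler_mean => // C _.
case: (boolP (k \in C)) => kC; last by rewrite mulr_ge0.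
have meets_k (S : ring) : k \in S -> meets C S.
  by move=> kS; apply/finset.set0Pn; exists k; rewrite inE kC.
by rewrite !meets_k ?mulr1.
Qed.

Lemma mean2_meets :
  mean mu (fun A => mean mu (fun B => (meets A B)%:R)) = 1 - Q.
Proof.
rewrite -[RHS](mean_cst mu1); apply: eq_mean_supp => A /key_ring_pmf_supp cA.
by under eq_mean do rewrite meetsC; rewrite mean_meets cA.
Qed.

Lemma triangle_prob_ge_mul : (1 - Q) * y <= triangle_prob.
Proof.
rewrite -(mean3_of_cond_mean mu1 mean2_triangle) -mean2_meets -meanZr.
apply: ler_mean => // A _; rewrite -meanZr; apply: ler_mean => // B _.
rewrite mean_triangle; case: (boolP (meets A B)) => [/meets_both_ge|_].
  by rewrite !mul1r.
by rewrite !mul0r.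
Qed.

(** Since [Q <= (1 - y) ^+ K] and, by Bernoulli's inequality, [1 + x <= (1 + y) ^+ K], the product
    [Q * (1 + x)] is at most [(1 - y ^+ 2) ^+ K]. *)
Lemma meet_prob_ge : x <= (1 - Q) * (1 + x).
Proof.
have y1 : 0 <= 1 - y by rewrite subr_ge0.
suff : Q * (1 + x) <= 1 by lra.
apply: le_trans (_ : (1 - y) ^+ K * (1 + y) ^+ K <= 1); last first.
  rewrite -exprMn -subr_sqr expr1n exprn_ile1 ?subr_ge0 ?expr_le1 //.
  by rewrite lerBlDr lerDl exprn_ge0.
apply: ler_pM; rewrite ?addr_ge0 ?divr_ge0 ?miss_prob_exp //.
rewrite x_eq; elim: K => [|k IH]; first by rewrite mul0r addr0 expr0.
rewrite exprS; apply: le_trans (ler_wpM2l _ IH); last by rewrite addr_ge0.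
have : 0 <= k%:R * y ^+ 2 by rewrite mulr_ge0 ?exprn_ge0.
by rewrite -natr1; nra.
Qed.

Lemma meets_le (A C : ring) :
  (meets A C)%:R <= \sum_(k in A) (k \in C)%:R :> R.
Proof.
case: (boolP (meets A C)) => [/finset.set0Pn[k]|_]; last exact: sumr_ge0.
rewrite inE => /andP[kA kC]; rewrite (bigD1 k) //= kC lerDl.
exact: sumr_ge0.
Qed.

Lemma meet_prob_le : 1 - Q <= x.
Proof.
rewrite -mean2_meets -[leRHS](mean_cst mu1).
apply: ler_mean => // A /key_ring_pmf_supp cA.
apply: le_trans (ler_mean _ (fun C _ => meets_le A C)) _ => //.
rewrite mean_sum; under eq_bigr do rewrite mean_mem.
by rewrite sumr_const cA x_eq mulr_natl.
Qed.

(* A ring meeting both [A] and [B] contains a common key of [A] and [B], or a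
   key of [A] and a different key of [B]. *)
Lemma meets_both_le (A B : ring) : #|A| = K -> #|B| = K ->
  meets_both A B <= #|A :&: B|%:R * y + x ^+ 2.
Proof.
move=> cA cB.
apply: le_trans (_ : mean mu (fun C => \sum_(k in A :&: B) (k \in C)%:R +
  \sum_(k in A) \sum_(l in B | k != l) (k \in C)%:R * (l \in C)%:R) <= _).
  apply: ler_mean => // C _.
  have S1 : 0 <= \sum_(k in A :&: B) (k \in C)%:R :> R by apply: sumr_ge0.
  have S2 k : 0 <= \sum_(l in B | k != l) (k \in C)%:R * (l \in C)%:R :> R.
    by apply: sumr_ge0 => l _; rewrite mulr_ge0.
  case: (boolP (meets C A)) => [/finset.set0Pn[k]|_]; last first.
    by rewrite mul0r addr_ge0 ?sumr_ge0.
  case: (boolP (meets C B)) => [/finset.set0Pn[l]|_]; last first.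
    by rewrite mulr0 addr_ge0 ?sumr_ge0.
  rewrite mulr1 !inE => /andP[lC lB] /andP[kC kA].
  case: (eqVneq k l) => [kl|kl].
    rewrite (bigD1 k) /=; last by rewrite inE kA kl.
    rewrite kC -addrA lerDl addr_ge0 ?sumr_ge0 //.
  rewrite -[leLHS]add0r lerD // (bigD1 k) //= (bigD1 l) /=; last by rewrite lB.
  rewrite kC lC mulr1 -addrA lerDl addr_ge0 ?sumr_ge0 //.
rewrite meanD mean_sum lerD //.
  under eq_bigr do rewrite mean_mem.
  by rewrite sumr_const mulr_natl.
have -> : x ^+ 2 = \sum_(k in A) \sum_(l in B) y ^+ 2.
  by rewrite !sumr_const cA cB -mulrnA x_eq -[RHS]mulr_natl natrM; ring.
rewrite mean_sum; apply: ler_sum => k _.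
rewrite mean_sum big_mkcondr /=; apply: ler_sum => l _.
by case: ifP => [/mean_mem2_le//|_]; rewrite exprn_ge0.
Qed.

(** The square counts ordered pairs of common keys, and independence of the rings gives each pair
    the mean [M k l ^+ 2]. The diagonal adds up to at most [P * y ^+ 2 = x], the rest to at most
    [P ^+ 2 * y ^+ 4 = x ^+ 2]. *)
Lemma mean2_sqr_cardI_le :
  mean mu (fun A => mean mu (fun B => #|A :&: B|%:R ^+ 2)) <= x + x ^+ 2.
Proof.
pose M (k l : 'I_P) := mean mu (fun C => (k \in C)%:R * (l \in C)%:R).
have -> : mean mu (fun A => mean mu (fun B => #|A :&: B|%:R ^+ 2)) =
    \sum_k \sum_l M k l ^+ 2.
  transitivity (mean mu (fun A => mean mu (fun B => \sum_k \sum_l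
      ((k \in A)%:R * (l \in A)%:R) * ((k \in B)%:R * (l \in B)%:R)))).
    apply: eq_mean => A; apply: eq_mean => B.
    have -> : #|A :&: B|%:R = \sum_k (k \in A)%:R * (k \in B)%:R :> R.
      rewrite -sum1_card natr_sum big_mkcond; apply: eq_bigr => k _.
      by rewrite inE; case: (k \in A); case: (k \in B);
        rewrite ?mulr1 ?mul0r ?mulr0.
    rewrite expr2 mulr_suml; apply: eq_bigr => k _.
    by rewrite mulr_sumr; apply: eq_bigr => l _; ring.
  under eq_mean do rewrite mean_sum; rewrite mean_sum; apply: eq_bigr => k _.
  under eq_mean do rewrite mean_sum; rewrite mean_sum; apply: eq_bigr => l _.
  by under eq_mean do rewrite meanZ; rewrite meanZr expr2.
apply: le_trans (_ : \sum_k \sum_l (y ^+ 4 + (k == l)%:R * y ^+ 2) <= _).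
  apply: ler_sum => k _; apply: ler_sum => l _.
  have M0 : 0 <= M k l by apply: mean_ge0 => // C; rewrite mulr_ge0.
  case: (eqVneq k l) => [<-|kl].
    rewrite mul1r -[leLHS]add0r lerD ?exprn_ge0 // /M.
    rewrite (@eq_mean _ _ _ _ (fun C : ring => (k \in C)%:R)) ?mean_mem //.
    by move=> C; case: (k \in C); rewrite ?mulr1 ?mulr0.
  rewrite mul0r addr0 (exprM _ 2 2) lerXn2r ?nnegrE ?exprn_ge0 //.
  exact: mean_mem2_le.
under eq_bigr do rewrite sum_indicator_affine.
rewrite sumr_const card_ord -mulr_natl /x /y.
by rewrite le_eqVlt; apply/orP; left; apply/eqP; field; rewrite gt_eqF.
Qed.

(** The bound of [meets_both_le] is squared term by term at the cost of a factor [2]. Its second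
    part is multiplied by the probability [1 - Q <= x] that the two rings meet, whence [x ^+ 5]. *)
Lemma shared_pair_mean_triangle_le :
  shared_pair_mean mu triangle <= 2 * y ^+ 2 * (x + x ^+ 2) + 2 * x ^+ 5.
Proof.
apply: le_trans (_ : mean mu (fun A => mean mu (fun B =>
   2 * y ^+ 2 * #|A :&: B|%:R ^+ 2 + 2 * x ^+ 4 * (meets A B)%:R)) <= _).
  apply: ler_mean => // A /key_ring_pmf_supp cA.
  apply: ler_mean => // B /key_ring_pmf_supp cB.
  rewrite mean_triangle; case: (boolP (meets A B)) => _; last first.
    by rewrite mul0r expr0n mulr0 addr0 !mulr_ge0 ?exprn_ge0.
  rewrite mul1r mulr1; set r := #|_|%:R.
  apply: le_trans (_ : (r * y + x ^+ 2) ^+ 2 <= _).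
    rewrite lerXn2r ?nnegrE ?addr_ge0 ?mulr_ge0 ?exprn_ge0 ?meets_both_le //.
    by apply: mean_ge0 => // C; rewrite mulr_ge0.
  have := sqr_ge0 (r * y - x ^+ 2); nra.
under eq_mean do rewrite meanD !meanZ.
rewrite meanD !meanZ mean2_meets lerD //.
  by rewrite ler_wpM2l ?mean2_sqr_cardI_le // mulr_ge0 ?exprn_ge0.
have -> : 2 * x ^+ 5 = 2 * x ^+ 4 * x by ring.
by rewrite ler_wpM2l ?meet_prob_le // mulr_ge0 ?exprn_ge0.
Qed.

End KeyRings.

Lemma q_miss_prob (R : realType) (K P : nat) : (0 < K)%N ->
  q R K P = miss_prob R K P K.
Proof.
move=> K0; rewrite /q /miss_prob; case: ltnP => // PK.
by rewrite [X in X%:R / _]bin_small ?mul0r //; lia.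
Qed.

(** The bound of [prob_no_triple_le] for key rings, with [m] nodes in each block. *)
Definition triangle_error (R : realType) (m K P : nat) : R :=
  3 * shared_pair_mean (@key_ring_pmf R K P) (@triangle P) /
    (m%:R * triangle_prob R K P) ^+ 2 +
  (m%:R ^+ 3 * triangle_prob R K P)^-1.

(** * From counted triples to triangles of the key graph *)

Section TriangleProbability.
Variables (R : realType) (n K P : nat).
Hypotheses (K_gt0 : (0 < K)%N) (leKP : (K <= P)%N).

Local Notation mu := (@key_ring_pmf R K P).

Lemma key_prob_has_triangle_le1 :
  key_prob R K (fun w : key_assignment n P => has_triangle (key_graph w)) <= 1.
Proof.
rewrite -(prod_pmf_sum1 'I_n (key_ring_pmf_sum1 R leKP)).
rewrite [leRHS](bigID (fun w : key_assignment n P =>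
  has_triangle (key_graph w))) /= lerDl.
by apply: sumr_ge0 => w _; apply: prod_pmf_ge0 => A; apply: key_ring_pmf_ge0.
Qed.

(** The first [3 * (n %/ 3)] nodes form the three blocks. Nodes of different blocks are distinct, so
    a counted triple is a triangle of the graph, and without triangles the count is zero. *)
Lemma key_prob_has_triangle_ge :
  (3 <= n)%N -> 0 < triangle_prob R K P ->
  1 - triangle_error R (n %/ 3) K P <=
  key_prob R K (fun w : key_assignment n P => has_triangle (key_graph w)).
Proof.
move=> n3 b0; set m := (n %/ 3)%N.
have m0 : (0 < m)%N by rewrite /m divn_gt0.
have blk_lt c (i : 'I_m) : (c < 3)%N -> (c * m + i < n)%N.
  by have := ltn_ord i; have := leq_trunc_div n 3; rewrite -/m; nia.
pose blk c (c3 : (c < 3)%N) (i : 'I_m) : 'I_n := Ordinal (blk_lt c i c3).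
pose u := blk 0%N isT; pose v := blk 1%N isT; pose s := blk 2%N isT.
have blk_inj c c3 : injective (@blk c c3).
  by move=> i j /(congr1 val) /= /addnI /val_inj.
have uv i j : u i != v j by rewrite -val_eqE /=; have := ltn_ord i; lia.
have us i j : u i != s j by rewrite -val_eqE /=; have := ltn_ord i; lia.
have vs i j : v i != s j by rewrite -val_eqE /=; have := ltn_ord i; lia.
have := @prob_no_triple_le R _ 'I_n mu (@key_ring_pmf_ge0 R K P)
  (key_ring_pmf_sum1 R leKP) (@triangle P) (triangle_prob R K P)
  (@triangle_swap12 P) (@triangle_swap23 P) (mean2_triangle leKP)
  'I_m u v s (blk_inj _ _) (blk_inj _ _) (blk_inj _ _) uv us vs.
rewrite card_ord ltr0n -/(triangle_error R m K P) => /(_ m0 b0) err.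
rewrite lerBlDr -[leLHS](prod_pmf_sum1 'I_n (key_ring_pmf_sum1 R leKP)).
rewrite (bigID (fun w : key_assignment n P => has_triangle (key_graph w))) /=.
rewrite lerD2l; apply: le_trans err.
rewrite [leLHS]big_mkcond [leRHS]big_mkcond /=; apply: ler_sum => w _.
have w0 : 0 <= prod_pmf mu w.
  by apply: prod_pmf_ge0 => A; apply: key_ring_pmf_ge0.
case: ifPn => [no_tri|_]; last by case: ifP.
suff -> : count_triples R (@triangle P) u v s w == 0 by [].
rewrite /count_triples big1 // => i _; rewrite big1 // => j _.
rewrite big1 // => k _; apply/eqP; rewrite pnatr_eq0 eqb0.
apply: contra no_tri => /and3P[ij jk ik].
apply/existsP; exists (u i); apply/existsP; exists (v j).
by apply/existsP; exists (s k); rewrite /key_graph uv us vs; apply/and3P.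
Qed.

End TriangleProbability.

(** The factor [5] is attained at [n = 5], where [n %/ 3 = 1]. *)
Lemma leq_5_divn3 n : (3 <= n)%N -> (n <= 5 * (n %/ 3))%N.
Proof. lia. Qed.

(** * Error estimates in the dense and sparse regimes *)

Section ErrorBounds.
Variables (R : realType) (n K P : nat).
Hypotheses (K_gt0 : (0 < K)%N) (leKP : (K <= P)%N) (n_ge3 : (3 <= n)%N).

Local Notation mu := (@key_ring_pmf R K P).
Let beta := triangle_prob R K P.
Let rho := shared_pair_mean mu (@triangle P).
Let m : R := (n %/ 3)%:R.

Let m_ge1 : 1 <= m.
Proof. by rewrite ler1n divn_gt0. Qed.

Let n_le_5m : n%:R <= 5 * m.
Proof. by rewrite -natrM ler_nat leq_5_divn3. Qed.

Lemma shared_pair_mean_triangle_le1 : rho <= 1.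
Proof.
have mu0 := @key_ring_pmf_ge0 R K P; have mu1 := key_ring_pmf_sum1 R leKP.
rewrite -[leRHS](mean_cst mu1); apply: ler_mean => // A _.
rewrite -[leRHS](mean_cst mu1); apply: ler_mean => // B _.
rewrite expr_le1 //; last by apply: mean_ge0.
by rewrite -[leRHS](mean_cst mu1); apply: ler_mean => // C _;
  rewrite lern1 leq_b1.
Qed.

(** The crude bounds [rho <= 1] and [beta >= d ^+ 3] suffice: both error terms are of order [1 / m],
    and [n <= 5 * m]. *)
Lemma triangle_error_dense (d : R) : 0 < d -> d <= 1 - q R K P ->
  0 < beta /\
  triangle_error R (n %/ 3) K P <= 5 * (3 / d ^+ 6 + 1 / d ^+ 3) / n%:R.
Proof.
move=> d0; rewrite q_miss_prob // => dq.
have db : d ^+ 3 <= beta.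
  apply: le_trans (triangle_prob_ge_cube R leKP).
  by rewrite lerXn2r ?nnegrE; lra.
have b0 : 0 < beta by apply: lt_le_trans db; rewrite exprn_gt0.
split=> //.
have m0 : 0 < m := lt_le_trans ltr01 m_ge1.
have n0 : 0 < n%:R :> R by rewrite ltr0n; lia.
set c := 3 / d ^+ 6 + 1 / d ^+ 3.
have c0 : 0 < c by rewrite addr_gt0 // divr_gt0 // exprn_gt0.
apply: le_trans (_ : c / m <= _); last first.
  by rewrite ler_pdivrMr // mulrAC ler_pdivlMr // -mulrA mulrCA ler_pM2l.
have dd k : 0 < d ^+ k by rewrite exprn_gt0.
have m_exp k : m <= m ^+ k.+1 by rewrite exprS ler_peMr ?(ltW m0) ?exprn_ege1.
rewrite /c mulrDl -!mulrA -!invfM mul1r lerD // -/rho -/beta -/m.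
  have r0 : 0 <= 3 * rho.
    rewrite mulr_ge0 // shared_pair_mean_ge0 // => A.
    exact: key_ring_pmf_ge0.
  rewrite ler_pM //.
  - by rewrite invr_ge0 exprn_ge0 // mulr_ge0 ?ltW.
  - by have := shared_pair_mean_triangle_le1; rewrite -/rho; lra.
  - rewrite lef_pV2 ?posrE ?mulr_gt0 ?exprn_gt0 ?mulr_gt0 //.
    rewrite exprMn mulrC ler_pM ?(ltW m0) ?(ltW (dd _)) // (exprM d 3 2).
    by rewrite lerXn2r ?nnegrE ?(ltW (dd _)) ?(ltW b0).
rewrite lef_pV2 ?posrE ?mulr_gt0 ?exprn_gt0 // mulrC.
by rewrite ler_pM ?(ltW m0) ?(ltW (dd _)).
Qed.

(** The parameter [a] is to be taken large. The factor [250] is [2 * 125], where [125] is the cube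
    of the [5] in [n <= 5 * m]. *)
Lemma triangle_error_sparse (a : R) :
  K%:R ^+ 2 / P%:R <= 1 :> R -> 1 <= a ->
  250 * a ^+ 2 <= n%:R ^+ 3 * tau R K P ->
  0 < beta /\ triangle_error R (n %/ 3) K P <= 3080 / a.
Proof.
set x := K%:R ^+ 2 / P%:R => x1 a1; set t := tau R K P => tn.
pose y : R := K%:R / P%:R; pose z : R := 1 - miss_prob R K P K.
have K0 : 0 < K%:R :> R by rewrite ltr0n.
have P0 : 0 < P%:R :> R by rewrite ltr0n; lia.
have y0 : 0 < y by rewrite divr_gt0.
have x0 : 0 < x by rewrite divr_gt0 ?exprn_gt0.
have yx : y <= x.
  by rewrite /x expr2 -mulrA ler_peMl ?(ltW y0) // ler1n.
have tE : t = x * y + x ^+ 3.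
  by rewrite /t /tau /x /y; field; rewrite gt_eqF.
have t0 : 0 < t by rewrite tE (addr_gt0 (mulr_gt0 x0 y0)) ?exprn_gt0.
have z_ge : x / 2 <= z.
  by have := meet_prob_ge R K_gt0 leKP; rewrite -/x -/z; nra.
have b1 : (x / 2) ^+ 3 <= beta.
  apply: le_trans (triangle_prob_ge_cube R leKP).
  by rewrite -/z lerXn2r ?nnegrE; lra.
have b2 : x / 2 * y <= beta.
  apply: le_trans (triangle_prob_ge_mul R K_gt0 leKP).
  by rewrite -/z -/y ler_pM2r.
(* [b2] and [b1] give [x * y <= 2 * beta] and [x ^+ 3 <= 8 * beta]; the sum [10] is rounded up to
   [16]. *)
have tb : t <= 16 * beta by rewrite tE; nra.
have b0 : 0 < beta by lra.
split=> //.
have x2 : x ^+ 3 <= x ^+ 2 by rewrite (exprS x 2) ler_piMl ?exprn_ge0 ?(ltW x0).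
have rt : x * rho <= 4 * t ^+ 2.
  have := shared_pair_mean_triangle_le R K_gt0 leKP.
  rewrite -/rho -/x -/y => /(ler_wpM2l (ltW x0)) /le_trans; apply.
  have -> : x * (2 * y ^+ 2 * (x + x ^+ 2) + 2 * x ^+ 5) =
    2 * (x ^+ 2 * y ^+ 2) + 2 * (x ^+ 3 * y ^+ 2) + 2 * x ^+ 6 by ring.
  have -> : 4 * t ^+ 2 = 4 * (x ^+ 2 * y ^+ 2) + 8 * (x ^+ 4 * y) + 4 * x ^+ 6.
    by rewrite tE; ring.
  have h1 : 0 <= x ^+ 4 * y by rewrite mulr_ge0 ?exprn_ge0 ?ltW.
  have h2 : 0 <= x ^+ 6 by rewrite exprn_ge0 ?ltW.
  have h3 : x ^+ 3 * y ^+ 2 <= x ^+ 2 * y ^+ 2.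
    by rewrite ler_wpM2r // mulr_ge0 ?ltW.
  have h4 : 0 <= x ^+ 2 * y ^+ 2 by rewrite mulr_ge0 ?exprn_ge0 ?ltW.
  lra.
have rb : x * rho <= 1024 * beta ^+ 2.
  apply: le_trans rt _.
  have : t ^+ 2 <= (16 * beta) ^+ 2 by rewrite lerXn2r ?nnegrE; lra.
  by rewrite exprMn; lra.
have n3m : n%:R ^+ 3 <= 125 * m ^+ 3.
  have -> : 125 * m ^+ 3 = (5 * m) ^+ 3 by ring.
  by rewrite lerXn2r ?nnegrE // mulr_ge0.
have tm : 2 * a ^+ 2 <= m ^+ 3 * t.
  by have := ler_wpM2r (ltW t0) n3m; lra.
have m0 : 0 < m := lt_le_trans ltr01 m_ge1.
(* Compare squares, using [2 * a ^+ 2 <= m ^+ 3 * t], [t <= 2 * x ^+ 2] and [m >= 1]. *)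
have ax : a <= m ^+ 2 * x.
  rewrite -(@ler_pXn2r _ 2) ?nnegrE ?mulr_ge0 ?exprn_ge0 ?(ltW m0) ?(ltW x0) //;
    last by lra.
  have t2 : t <= 2 * x ^+ 2.
    by rewrite tE; have := ler_wpM2l (ltW x0) yx; rewrite -expr2; lra.
  have m34 : m ^+ 3 <= m ^+ 4.
    by rewrite (exprS m 3) ler_peMl ?exprn_ge0 ?(ltW m0).
  have h1 := ler_wpM2l (exprn_ge0 3 (ltW m0)) t2.
  have h2 := ler_wpM2r (exprn_ge0 2 (ltW x0)) m34.
  by rewrite exprMn -exprM; lra.
have a0 : 0 < a by lra.
(* The shared-edge term is at most [3 * 1024 / a] by [rb] and [ax]; the other is at most [8 / a] by
   [tb], [tm] and [a <= a ^+ 2]. *)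
have -> : 3080 / a = 3072 / a + 8 / a by rewrite -mulrDl; congr (_ / _); ring.
rewrite lerD // -/rho -/beta -/m.
  rewrite ler_pdivrMr ?exprn_gt0 ?mulr_gt0 // mulrAC ler_pdivlMr //.
  have r0 : 0 <= rho.
    by apply: shared_pair_mean_ge0 => A; apply: key_ring_pmf_ge0.
  have h1 := ler_wpM2l r0 ax.
  have h2 := ler_wpM2l (exprn_ge0 2 (ltW m0)) rb.
  by rewrite exprMn; lra.
have -> : 8 / a = (a / 8)^-1 by rewrite invf_div.
have m3b : 0 < m ^+ 3 * beta by rewrite mulr_gt0 ?exprn_gt0.
rewrite lef_pV2 ?posrE ?divr_gt0 //.
have h1 := ler_wpM2l (exprn_ge0 3 (ltW m0)) tb.
have h2 : a <= a ^+ 2 by rewrite expr2 ler_peMl ?(ltW a0).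
lra.
Qed.

End ErrorBounds.

(** * Passage to the limit *)

Theorem theorem3p2 (R : realType) (K P : nat -> nat) (qstar : R)
    (hscaling : scaling K P)
    (hq : q R (K n) (P n) @[n --> \oo] --> qstar)
    (hcase : (0 <= qstar < 1) \/
             (qstar = 1 /\
              (n%:R ^+ 3 * tau R (K n) (P n) : R) @[n --> \oo] --> +oo)) :
  key_prob R (K n) (fun w : key_assignment n (P n) =>
    has_triangle (key_graph w)) @[n --> \oo] --> (1 : R).
Proof.
(* From [n = 3] on, the blocks are nonempty and [scaling] constrains both [K n] and [P n]. *)
have hKP n : (3 <= n)%N -> (0 < K n)%N /\ (K n <= P n)%N.
  move=> n3; case: hscaling => s1 s2.
  by split; [case: (s1 n); lia | apply: s2; lia].
suff err_small e : 0 < e -> \forall n \near \oo,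
    0 < triangle_prob R (K n) (P n) /\
    triangle_error R (n %/ 3) (K n) (P n) < e.
  apply/cvgrPdist_lt => e e0.
  apply: filterS2 (err_small e e0) (nbhs_infty_ge 3) => n [b0 err] /= n3.
  have [K0 KP] := hKP n n3.
  have p1 := key_prob_has_triangle_le1 R n KP.
  have p2 := key_prob_has_triangle_ge K0 KP n3 b0.
  by rewrite ger0_norm; lra.
move=> e0; have near_q d : 0 < d ->
    \forall n \near \oo, `|qstar - q R (K n) (P n)| < d.
  by move=> d0; move/cvgrPdist_lt: hq; apply.
case: hcase => [/andP[_ q1]|[q1 htau]].
  (* Half of the limiting gap: eventually [q] is below [qstar + d = 1 - d]. *)
  pose d : R := (1 - qstar) / 2.
  have d0 : 0 < d by rewrite /d; lra.
  pose c : R := 5 * (3 / d ^+ 6 + 1 / d ^+ 3).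
  apply: filterS3 (near_q d d0) (nbhs_infty_gtr (c / e)) (nbhs_infty_ge 3).
  move=> n /= qn cn n3; have [K0 KP] := hKP n n3.
  have dq : d <= 1 - q R (K n) (P n).
    have : 2 * d = 1 - qstar by rewrite /d; field.
    by move: qn; rewrite ltr_norml => /andP[? ?]; lra.
  have [b0 err] := triangle_error_dense K0 KP n3 d0 dq.
  split=> //; apply: le_lt_trans err _.
  have n0 : 0 < n%:R :> R by rewrite ltr0n; lia.
  by rewrite ltr_pdivrMr // [ltRHS]mulrC -ltr_pdivrMr.
(* Chosen so that [a * e = e + 3080], hence [3080 / a < e]. *)
pose a : R := 1 + 3080 / e.
have e3080 : 0 < 3080 / e by rewrite divr_gt0 ?ltr0n.
have a1 : 1 <= a by rewrite lerDl ltW.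
(* Once [q > 1 / 2], [meet_prob_ge] gives [x <= (1 + x) / 2], that is [x <= 1], as the sparse
   estimate requires. *)
have half_gt0 : 0 < 1 / 2 :> R by lra.
move/cvgryPge/(_ (250 * a ^+ 2)): htau => near_tau.
apply: filterS3 (near_q _ half_gt0) near_tau (nbhs_infty_ge 3).
move=> n /= qn tn n3; have [K0 KP] := hKP n n3.
have x1 : (K n)%:R ^+ 2 / (P n)%:R <= 1 :> R.
  have := meet_prob_ge R K0 KP; rewrite -q_miss_prob //.
  have : 0 <= (K n)%:R ^+ 2 / (P n)%:R :> R by rewrite divr_ge0 ?exprn_ge0.
  move: qn; rewrite q1 ltr_norml => /andP[_]; nra.
have [b0 err] := triangle_error_sparse K0 KP n3 x1 a1 tn.
split=> //; apply: le_lt_trans err _.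
rewrite ltr_pdivrMr; last by lra.
by rewrite /a mulrDr mulrCA divff ?gt_eqF //; lra.
Qed.
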